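(* The sequent calculus $\mu LJ$ is consistent: there is no derivation of the sequent $\vdash\bot$ (with empty left-hand side).
   Context: Formulas of $\mu LJ$: $S::=S\Rightarrow T\mid S\vee T\mid S\wedge T\mid \mu X.T\mid \nu X.T\mid X\mid\top\mid\bot$, with $X$ ranging over type variables. A formula is valid if for every subformula $\mu X.F'$ (the paper states this for $\mu$): (1) $X$ appears only positively in $F'$ (i.e. under an even number of left-hand sides of $\Rightarrow$); (2) $X$ does not appear at the root of $F'$, i.e. every occurrence of $X$ is below at least one $\vee$ or $\Rightarrow$ in the syntax tree of $F'$. Only valid formulas are used. $T[A/X]$ is substitution, abbreviated $T(A)$. Sequents are $\Gamma\vdash B$ with $\Gamma$ a finite list of formulas. Rules: Identity: $A\vdash A$ (ax); from $\Gamma\vdash A$ and $\Delta,A\vdash B$ infer $\Gamma,\Delta\vdash B$ (Cut). Structural: from $\Gamma,A,A\vdash B$ infer $\Gamma,A\vdash B$; from $\Gamma\vdash B$ infer $\Gamma,A\vdash B$; from $\Gamma,A,B,\Delta\vdash C$ infer $\Gamma,B,A,\Delta\vdash C$. Logical: from $\Gamma,A\vdash B$ infer $\Gamma\vdash A\Rightarrow B$; from $\Gamma\vdash A$ and $\Delta,B\vdash C$ infer $\Gamma,\Delta,A\Rightarrow B\vdash C$; $\Gamma,\bot\vdash A$; $\Gamma\vdash\top$; from $\Gamma\vdash A$ and $\Gamma\vdash B$ infer $\Gamma\vdash A\wedge B$; from $\Gamma,A\vdash C$ infer $\Gamma,A\wedge B\vdash C$; from $\Gamma,B\vdash C$ infer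 $\Gamma,A\wedge B\vdash C$; from $\Gamma\vdash A$ infer $\Gamma\vdash A\vee B$; from $\Gamma\vdash B$ infer $\Gamma\vdash A\vee B$; from $\Gamma,A\vdash C$ and $\Delta,B\vdash C$ infer $\Gamma,\Delta,A\vee B\vdash C$. Fixpoints: from $\Gamma\vdash T[\mu X.T/X]$ infer $\Gamma\vdash\mu X.T$; from $T[A/X]\vdash A$ infer $\mu X.T\vdash A$; from $T[\nu X.T/X]\vdash B$ infer $\nu X.T\vdash B$; from $A\vdash T[A/X]$ infer $A\vdash\nu X.T$. Functors: if $X$ appears only positively in $T$, from $A\vdash B$ infer $T(A)\vdash T(B)$; if $X$ appears only negatively in $N$, from $A\vdash B$ infer $N(B)\vdash N(A)$. *)

(* Defs.v *)
From mathcomp Require Import all_boot.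
Set Implicit Arguments.
Unset Strict Implicit.
Unset Printing Implicit Defensive.

(* Type variables are de Bruijn indices, so formulas are taken up to
   alpha-equivalence: [Mu T] and [Nu T] bind index 0 in [T].  Formulas may have
   free variables. *)
Inductive formula : Type :=
| Var of nat
| Top
| Bot
| Imp of formula & formula
| And of formula & formula
| Or of formula & formula
| Mu of formula
| Nu of formula.

Definition up_ren (r : nat -> nat) (n : nat) : nat :=
  if n is m.+1 then (r m).+1 else 0.

Fixpoint rename (r : nat -> nat) (A : formula) : formula :=
  match A with
  | Var n => Var (r n)
  | Top => Top
  | Bot => Bot
  | Imp B C => Imp (rename r B) (rename r C)
  | And B C => And (rename r B) (rename r C)
  | Or B C => Or (rename r B) (rename r C)
  | Mu T => Mu (rename (up_ren r) T)
  | Nu T => Nu (rename (up_ren r) T)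
  end.

Definition up_sub (s : nat -> formula) (n : nat) : formula :=
  if n is m.+1 then rename succn (s m) else Var 0.

Fixpoint subst (s : nat -> formula) (A : formula) : formula :=
  match A with
  | Var n => s n
  | Top => Top
  | Bot => Bot
  | Imp B C => Imp (subst s B) (subst s C)
  | And B C => And (subst s B) (subst s C)
  | Or B C => Or (subst s B) (subst s C)
  | Mu T => Mu (subst (up_sub s) T)
  | Nu T => Nu (subst (up_sub s) T)
  end.

(* T[A/X], where X is index 0 of [T]; the remaining free indices of [T] are
   lowered by one, as [A] lives outside the scope of X. *)
Definition inst (T A : formula) : formula :=
  subst (fun n => if n is m.+1 then Var m else A) T.

(* Every free occurrence of variable [n] in [A] lies under an even ([s = true])
   or odd ([s = false]) number of left-hand sides of implications. *)
Fixpoint signed (s : bool) (n : nat) (A : formula) : bool :=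
  match A with
  | Var m => (m == n) ==> s
  | Top | Bot => true
  | Imp B C => signed (~~ s) n B && signed s n C
  | And B C | Or B C => signed s n B && signed s n C
  | Mu T | Nu T => signed s n.+1 T
  end.

Definition positive_in (n : nat) (A : formula) : bool := signed true n A.
Definition negative_in (n : nat) (A : formula) : bool := signed false n A.

(* Every free occurrence of variable [n] in [A] is below at least one
   disjunction or implication; conjunctions and binders do not guard. *)
Fixpoint guarded (n : nat) (A : formula) : bool :=
  match A with
  | Var m => m != n
  | Top | Bot | Imp _ _ | Or _ _ => true
  | And B C => guarded n B && guarded n C
  | Mu T | Nu T => guarded n.+1 T
  end.

(* Positivity and guardedness are required of the least fixpoints only. *)
Fixpoint valid (A : formula) : bool :=
  match A with
  | Var _ | Top | Bot => true
  | Imp B C | And B C | Or B C => valid B && valid C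
  | Mu T => [&& positive_in 0 T, guarded 0 T & valid T]
  | Nu T => valid T
  end.

Definition valid_sequent (G : seq formula) (B : formula) : bool :=
  all valid G && valid B.

(* [derivable G B]: the sequent G |- B has a derivation.  Each rule requires its
   conclusion to consist of valid formulas, hence every sequent of a derivation
   does.  The context "G, A" is [rcons G A]. *)
Inductive derivable : seq formula -> formula -> Prop :=
| d_ax A :
    valid_sequent [:: A] A ->
    derivable [:: A] A
| d_cut G D A B :
    valid_sequent (G ++ D) B ->
    derivable G A -> derivable (rcons D A) B ->
    derivable (G ++ D) B

| d_contraction G A B :
    valid_sequent (rcons G A) B ->
    derivable (rcons (rcons G A) A) B ->
    derivable (rcons G A) B
| d_weakening G A B :
    valid_sequent (rcons G A) B ->
    derivable G B ->
    derivable (rcons G A) B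
| d_exchange G D A B C :
    valid_sequent (G ++ [:: B, A & D]) C ->
    derivable (G ++ [:: A, B & D]) C ->
    derivable (G ++ [:: B, A & D]) C

| d_imp_r G A B :
    valid_sequent G (Imp A B) ->
    derivable (rcons G A) B ->
    derivable G (Imp A B)
| d_imp_l G D A B C :
    valid_sequent (rcons (G ++ D) (Imp A B)) C ->
    derivable G A -> derivable (rcons D B) C ->
    derivable (rcons (G ++ D) (Imp A B)) C
| d_bot_l G A :
    valid_sequent (rcons G Bot) A ->
    derivable (rcons G Bot) A
| d_top_r G :
    valid_sequent G Top ->
    derivable G Top
| d_and_r G A B :
    valid_sequent G (And A B) ->
    derivable G A -> derivable G B ->
    derivable G (And A B)
| d_and_l1 G A B C :
    valid_sequent (rcons G (And A B)) C ->
    derivable (rcons G A) C ->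
    derivable (rcons G (And A B)) C
| d_and_l2 G A B C :
    valid_sequent (rcons G (And A B)) C ->
    derivable (rcons G B) C ->
    derivable (rcons G (And A B)) C
| d_or_r1 G A B :
    valid_sequent G (Or A B) ->
    derivable G A ->
    derivable G (Or A B)
| d_or_r2 G A B :
    valid_sequent G (Or A B) ->
    derivable G B ->
    derivable G (Or A B)
| d_or_l G D A B C :
    valid_sequent (rcons (G ++ D) (Or A B)) C ->
    derivable (rcons G A) C -> derivable (rcons D B) C ->
    derivable (rcons (G ++ D) (Or A B)) C

| d_mu_r G T :
    valid_sequent G (Mu T) ->
    derivable G (inst T (Mu T)) ->
    derivable G (Mu T)
| d_mu_l T A :
    valid_sequent [:: Mu T] A ->
    derivable [:: inst T A] A ->
    derivable [:: Mu T] A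
| d_nu_l T B :
    valid_sequent [:: Nu T] B ->
    derivable [:: inst T (Nu T)] B ->
    derivable [:: Nu T] B
| d_nu_r T A :
    valid_sequent [:: A] (Nu T) ->
    derivable [:: A] (inst T A) ->
    derivable [:: A] (Nu T)

| d_functor_pos T A B :
    valid T -> positive_in 0 T ->
    valid_sequent [:: inst T A] (inst T B) ->
    derivable [:: A] B ->
    derivable [:: inst T A] (inst T B)
| d_functor_neg N A B :
    valid N -> negative_in 0 N ->
    valid_sequent [:: inst N B] (inst N A) ->
    derivable [:: A] B ->
    derivable [:: inst N B] (inst N A).

(* Main.v *)
Require Import Defs.
From mathcomp Require Import all_boot.
Set Implicit Arguments.
Unset Strict Implicit.
Unset Printing Implicit Defensive.

(** Soundness for two-valued truth semantics.  On booleans every operator [F],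
    monotone or not, has a least prefixed point [F false] and a greatest
    postfixed point [F true], so the fixpoint rules are sound without any
    positivity assumption; positivity only matters for the functor rules. *)

Definition env_cons (b : bool) (e : nat -> bool) (n : nat) : bool :=
  if n is m.+1 then e m else b.

Fixpoint truth (e : nat -> bool) (A : formula) : bool :=
  match A with
  | Var n => e n
  | Top => true
  | Bot => false
  | Imp B C => truth e B ==> truth e C
  | And B C => truth e B && truth e C
  | Or B C => truth e B || truth e C
  | Mu T => truth (env_cons false e) T
  | Nu T => truth (env_cons true e) T
  end.

(** The environments are related pointwise, because under a binder [env_cons] and [up_ren] commute
    only index by index; no function extensionality is needed. *)
Lemma truth_rename A r e e' :
  (forall n, e' n = e (r n)) -> truth e (rename r A) = truth e' A.
Proof.
elim: A r e e' => [n||| A IHA B IHB | A IHA B IHB | A IHA B IHB | A IHA | A IHA]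
  r e e' ee' //=; rewrite ?(IHA _ _ _ ee') ?(IHB _ _ _ ee') //;
  by apply: IHA => -[].
Qed.

Lemma truth_subst A s e e' :
  (forall n, e' n = truth e (s n)) -> truth e (subst s A) = truth e' A.
Proof.
elim: A s e e' => [n||| A IHA B IHB | A IHA B IHB | A IHA B IHB | A IHA | A IHA]
  s e e' ee' //=; rewrite ?(IHA _ _ _ ee') ?(IHB _ _ _ ee') //;
  by apply: IHA => -[|n] //=; rewrite ee'; apply/esym/truth_rename.
Qed.

(** Each fixpoint rule thereby becomes a statement about the boolean function
    [F b := truth (env_cons b e) T]. *)
Lemma truth_inst T A e :
  truth e (inst T A) = truth (env_cons (truth e A) e) T.
Proof. by apply: truth_subst => -[]. Qed.

(** Both polarities are proved at once, since the left side of an implication flips [s]. Binders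
    extend both environments by the same bit, so they still differ at most at the shifted index. *)
Lemma truth_signed A s n (e e' : nat -> bool) :
    (forall m, m != n -> e m = e' m) -> (e n -> e' n) -> signed s n A ->
  if s then truth e A -> truth e' A else truth e' A -> truth e A.
Proof.
elim: A s n e e' => [m||| A IHA B IHB | A IHA B IHB | A IHA B IHB | A IHA | A IHA]
  s n e e' off at_n /=.
- by have [->|/off->] := eqVneq m n; case: s.
- by case: s.
- by case: s.
- case/andP=> /(IHA _ _ _ _ off at_n) + /(IHB _ _ _ _ off at_n).
  by case: s => /= hA hB /implyP h; apply/implyP => /hA /h /hB.
- case/andP=> /(IHA _ _ _ _ off at_n) + /(IHB _ _ _ _ off at_n).
  by case: s => hA hB /andP[/hA-> /hB->].
- case/andP=> /(IHA _ _ _ _ off at_n) + /(IHB _ _ _ _ off at_n).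
  by case: s => hA hB /orP[/hA->|/hB->] //; rewrite orbT.
- by apply: IHA => // -[|m] //=; rewrite eqSS; apply: off.
- by apply: IHA => // -[|m] //=; rewrite eqSS; apply: off.
Qed.

Lemma truth_inst_signed s T A B e :
    signed s 0 T -> (truth e A -> truth e B) ->
  if s then truth e (inst T A) -> truth e (inst T B)
  else truth e (inst T B) -> truth e (inst T A).
Proof.
move=> sT AB; rewrite !truth_inst.
by apply: truth_signed sT => // -[].
Qed.

(** This is [F (F false) -> F false]: if [F false] is false, the premise is [F false] itself. *)
Lemma truth_mu_fold T e : truth e (inst T (Mu T)) -> truth e (Mu T).
Proof. by rewrite truth_inst /=; case E: (truth (env_cons false e) T); rewrite ?E. Qed.

(** Only a false [A] matters, and then [inst T A] has the value [F false] of [Mu T]. *)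
Lemma truth_mu_ind T A e :
  (truth e (inst T A) -> truth e A) -> truth e (Mu T) -> truth e A.
Proof. by rewrite truth_inst /=; case: (truth e A). Qed.

Lemma truth_nu_unfold T e : truth e (Nu T) -> truth e (inst T (Nu T)).
Proof. by rewrite truth_inst /= => nuT; rewrite nuT. Qed.

Lemma truth_nu_coind T A e :
  (truth e A -> truth e (inst T A)) -> truth e A -> truth e (Nu T).
Proof. by rewrite truth_inst /=; case: (truth e A) => // /(_ isT). Qed.

(** One fixed [e] suffices for the induction: rules open binders by [inst], so no premise needs an
    extended environment. *)
Lemma derivable_truth G B e : derivable G B -> all (truth e) G -> truth e B.
Proof.
have all1 A : all (truth e) [:: A] = truth e A by rewrite /= andbT.
elim=> {G B}
  [A _ | G D A B _ _ hA _ hB | G A B _ _ h | G A B _ _ h | G D A B C _ _ h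
  | G A B _ _ h | G D A B C _ _ hA _ hC | G A _ | // | G A B _ _ hA _ hB
  | G A B C _ _ h | G A B C _ _ h | G A B _ _ h | G A B _ _ h
  | G D A B C _ _ hA _ hB | G T _ _ h | T A _ _ h | T B _ _ h | T A _ _ h
  | T A B _ pT _ _ h | N A B _ nN _ _ h].
- by rewrite all1.
- by rewrite all_cat => /andP[/hA tA tD]; apply: hB; rewrite all_rcons tA.
- by move=> tG; apply: h; move: tG; rewrite !all_rcons => /andP[-> ->].
- by rewrite all_rcons => /andP[_ /h].
- by move=> tG; apply: h; move: tG; rewrite !all_cat /= (andbCA (truth e A)).
- by move=> tG /=; apply/implyP => tA; apply: h; rewrite all_rcons tA.
- rewrite all_rcons all_cat /= => /and3P[/implyP AB /hA /AB tB tD].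
  by apply: hC; rewrite all_rcons tB.
- by rewrite all_rcons.
- by move=> tG /=; rewrite hA ?hB.
- by rewrite all_rcons /= => /andP[/andP[tA _] tG]; apply: h; rewrite all_rcons tA.
- by rewrite all_rcons /= => /andP[/andP[_ tB] tG]; apply: h; rewrite all_rcons tB.
- by move=> /h /= ->.
- by move=> /h /= ->; rewrite orbT.
- rewrite all_rcons all_cat /= => /and3P[/orP[t|t] tG tD].
  + by apply: hA; rewrite all_rcons t.
  + by apply: hB; rewrite all_rcons t.
- by move=> /h /truth_mu_fold.
- by rewrite all1; apply: truth_mu_ind; rewrite -all1.
- by rewrite all1 => /truth_nu_unfold tT; apply: h; rewrite all1.
- by rewrite all1; apply: truth_nu_coind; rewrite -all1.
(* The sign hypothesis [pT] or [nN] fixes [s], which selects the direction of the implication. *)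
- by rewrite all1; apply: (truth_inst_signed pT); rewrite -all1.
- by rewrite all1; apply: (truth_inst_signed nN); rewrite -all1.
Qed.

Theorem theorem4 : ~ derivable [::] Bot.
(* Any environment would do: the empty context holds in it and [Bot] does not. *)
Proof. by move=> /(derivable_truth (e := fun=> false)) /(_ isT). Qed.
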